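(* Let $F$ be a function on natural numbers computed by a deterministic one-tape Turing machine in $f(n)$ steps on inputs of length $n$. If input and output are represented in binary (or more generally in a base that is a power of two), then $F$ can be computed by a register machine with three registers in $O(f(n)+n)$ steps. If input and output are represented in bases $i$ and $j$ respectively, for arbitrary fixed $i,j\geq 2$, then $F$ can be computed by a register machine with four registers in $O(f(n)+n)$ steps.
   Context: Model (addition machine): a program is a finite list of numbered lines; the machine has finitely many registers, each holding an arbitrary integer. Allowed commands, each counting as one step: $x=y+z$, $x=y+c$, $x=y-z$, $x=y-c$, $x=c-y$, $x=c$ (registers $x,y,z$, integer constants $c$); ''read $x$''/''write $x$'' of a whole integer; conditionals ''if $x\,R\,y$'' and ''if $x\,R\,c$'' with $R\in\{<,=,>,\neq,\leq,\geq\}$; ''goto $\ell$''. Finitely many variables with a fixed finite range of values may also be used and do not count as registers. The register machine reads the input as one integer and writes the output as one integer; the Turing machine works on the digit strings of these numbers. Running time is the number of executed commands. *)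

(* Defs.v *)
From HB Require Import structures.
From mathcomp Require Import all_boot all_order all_algebra.

Set Implicit Arguments.
Unset Strict Implicit.
Unset Printing Implicit Defensive.

Import Order.TTheory GRing.Theory Num.Theory.

(* Digits of n in base b, most significant first and without leading zeros;
   0 is written [:: 0].  For 2 <= b the fuel n.+1 is never exhausted. *)
Fixpoint digits_rec (b fuel n : nat) : seq nat :=
  if fuel is fuel'.+1 then
    if n < b then [:: n] else rcons (digits_rec b fuel' (n %/ b)) (n %% b)
  else [::].

Definition digits (b n : nat) : seq nat := digits_rec b n.+1 n.

(* Exactly t steps; None if no step is possible before that. *)
Fixpoint run (C : Type) (step : C -> option C) (t : nat) (c : C) : option C :=
  if t is t'.+1 then obind (run step t') (step c) else Some c.

Inductive move := MoveL | MoveR | Stay.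

(* Deterministic one-tape machines reading base-i and producing base-j numbers.
   The two digit encodings may or may not share symbols, and the tape alphabet
   may contain further symbols.  The machine halts when tm_delta is None. *)
Record tm (i j : nat) := TM {
  tm_state : finType;
  tm_symbol : finType;
  tm_start : tm_state;
  tm_blank : tm_symbol;
  tm_din : nat -> tm_symbol;
  tm_dout : nat -> tm_symbol;
  tm_delta : tm_state -> tm_symbol -> option (tm_state * tm_symbol * move);
  tm_din_inj : {in gtn i &, injective tm_din};
  tm_dout_inj : {in gtn j &, injective tm_dout};
  tm_din_blank : forall d, d < i -> tm_din d != tm_blank;
  tm_dout_blank : forall d, d < j -> tm_dout d != tm_blank
}.

(* The tape is infinite in both directions: tm_left lists the cells to the left
   of the head, nearest first; tm_right lists the scanned cell and the cells to
   its right; all cells not listed are blank. *)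
Record tm_config i j (M : tm i j) := TMConfig {
  tm_ctl : tm_state M;
  tm_left : seq (tm_symbol M);
  tm_right : seq (tm_symbol M)
}.

Definition tm_step i j (M : tm i j) (c : tm_config M) : option (tm_config M) :=
  let: TMConfig q l r := c in
  let b := tm_blank M in
  match tm_delta q (head b r) with
  | None => None
  | Some (q', s, m) =>
      let r' := s :: behead r in
      Some (match m with
            | MoveL => TMConfig q' (behead l) (head b l :: r')
            | MoveR => TMConfig q' (s :: l) (behead r)
            | Stay => TMConfig q' l r'
            end)
  end.

Definition tm_init i j (M : tm i j) (x : nat) : tm_config M :=
  TMConfig (tm_start M) [::] (map (tm_din M) (digits i x)).

(* The tape holds the output and nothing else; the head may be anywhere. *)
Definition tm_output i j (M : tm i j) (c : tm_config M) (y : nat) : Prop :=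
  exists a b : nat,
    rev (tm_left c) ++ tm_right c =
      nseq a (tm_blank M) ++ map (tm_dout M) (digits j y)
        ++ nseq b (tm_blank M).

Definition tm_computes_in i j (M : tm i j) (F f : nat -> nat) : Prop :=
  forall x : nat, exists (t : nat) (c : tm_config M),
    [/\ t <= f (size (digits i x)),
        run (@tm_step i j M) t (tm_init M x) = Some c,
        tm_step c = None
      & tm_output c (F x)].

Inductive cmp := CLt | CEq | CGt | CNe | CLe | CGe.

Definition eval_cmp (R : cmp) (a b : int) : bool :=
  match R with
  | CLt => (a < b)%R
  | CEq => a == b
  | CGt => (a > b)%R
  | CNe => a != b
  | CLe => (a <= b)%R
  | CGe => (a >= b)%R
  end.

(* Commands with registers 'I_k.  V is the finite type of joint values of the
   finite-range variables, so any number of such variables is a single V. *)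
Inductive command (k : nat) (V : finType) :=
  | Add (x y z : 'I_k)                        (* x = y + z *)
  | AddC (x y : 'I_k) (c : int)               (* x = y + c *)
  | Sub (x y z : 'I_k)                        (* x = y - z *)
  | SubC (x y : 'I_k) (c : int)               (* x = y - c *)
  | CSub (x : 'I_k) (c : int) (y : 'I_k)      (* x = c - y *)
  | Const (x : 'I_k) (c : int)                (* x = c *)
  | Read (x : 'I_k)
  | Write (x : 'I_k)
  | If (x : 'I_k) (R : cmp) (y : 'I_k) (l : nat)  (* if x R y then goto l *)
  | IfC (x : 'I_k) (R : cmp) (c : int) (l : nat)  (* if x R c then goto l *)
  | Goto (l : nat)
  | FinSet (g : {ffun V -> V})                (* v = g(v) *)
  | FinIf (A : {set V}) (l : nat).            (* if v \in A then goto l *)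

(* Lines are numbered from 0; leaving the list of lines halts the machine. *)
Record program (k : nat) := Program {
  prog_var : finType;
  prog_var0 : prog_var;
  prog_code : seq (command k prog_var)
}.

Record rm_config k (P : program k) := RMConfig {
  rm_pc : nat;
  rm_reg : {ffun 'I_k -> int};
  rm_var : prog_var P;
  rm_in : seq int;
  rm_out : seq int
}.

Definition upd k (r : {ffun 'I_k -> int}) (x : 'I_k) (a : int) :
    {ffun 'I_k -> int} :=
  [ffun y => if y == x then a else r y].

Definition exec k (P : program k) (cmd : command k (prog_var P))
    (c : rm_config P) : option (rm_config P) :=
  let: RMConfig pc r v inp out := c in
  let assign x a := Some (RMConfig pc.+1 (upd r x a) v inp out) in
  let jump (b : bool) l := Some (RMConfig (if b then l else pc.+1) r v inp out) in
  match cmd with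
  | Add x y z => assign x (r y + r z)%R
  | AddC x y a => assign x (r y + a)%R
  | Sub x y z => assign x (r y - r z)%R
  | SubC x y a => assign x (r y - a)%R
  | CSub x a y => assign x (a - r y)%R
  | Const x a => assign x a
  | Read x =>
      if inp is a :: inp' then Some (RMConfig pc.+1 (upd r x a) v inp' out)
      else None
  | Write x => Some (RMConfig pc.+1 r v inp (rcons out (r x)))
  | If x R y l => jump (eval_cmp R (r x) (r y)) l
  | IfC x R a l => jump (eval_cmp R (r x) a) l
  | Goto l => jump true l
  | FinSet g => Some (RMConfig pc.+1 r (g v) inp out)
  | FinIf A l => jump (v \in A) l
  end.

Definition rm_step k (P : program k) (c : rm_config P) : option (rm_config P) :=
  if onth (prog_code P) (rm_pc c) is Some cmd then exec cmd c else None.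

Definition rm_init k (P : program k) (x : nat) : rm_config P :=
  RMConfig 0 [ffun=> 0%R] (prog_var0 P) [:: Posz x] [::].

(* A machine stuck on a Read without input has not halted properly, hence the
   condition on rm_pc. *)
Definition rm_computes_within k (P : program k) (x y t : nat) : Prop :=
  exists (t' : nat) (c : rm_config P),
    [/\ t' <= t,
        run (@rm_step k P) t' (rm_init P x) = Some c,
        size (prog_code P) <= rm_pc c
      & rm_out c = [:: Posz y]].

(* F is computed with k registers in O(T(n)) steps, n being the number of
   base-i digits of the argument. *)
Definition rm_computable_in_O (k i : nat) (F T : nat -> nat) : Prop :=
  exists (P : program k) (C : nat), forall x : nat,
    rm_computes_within P x (F x) (C * T (size (digits i x))).

(* Main.v *)
(** A stack of base-[B] digits, top first, is kept as a fraction [x / y] with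
these digits after the point.  Pushing [d] replaces [x / y] by
[(x + d y) / (B y)]; popping replaces [x] by [B x] and subtracts [y] as often
as possible, the number of subtractions being the digit.  The two halves of
the tape share one denominator [y], which only ever grows: when one stack is
pushed, the other numerator is multiplied by [B] as well.  So three registers
simulate a Turing step in constant time once multiplication by [B] is possible
in place, by doubling if [B] is a power of two, and otherwise with a scratch
register.  The input [x] in base [i] is itself a stack [x / i^n], from which
the digits are transferred to the tape most significant first; the output is
evaluated by Horner's rule while the tape is being popped.  Both take linear
time. *)

Require Import Defs.
From mathcomp Require Import all_boot all_order all_algebra.
From mathcomp Require Import zify.

Set Implicit Arguments.
Unset Strict Implicit.
Unset Printing Implicit Defensive.

Import Order.TTheory GRing.Theory Num.Theory.

Lemma run_add (C : Type) (step : C -> option C) (s t : nat) (c : C) :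
  run step (s + t) c = obind (run step t) (run step s c).
Proof. by elim: s c => //= s IHs c; case: (step c) => //= c'; rewrite IHs. Qed.

(** * Structured programs over three registers *)

Inductive reg := RA | RB | RY.

Record state (V : Type) := St { sv : V; sa : int; sb : int; sy : int }.

Definition get V (s : state V) (x : reg) : int :=
  match x with RA => sa s | RB => sb s | RY => sy s end.

Definition set V (s : state V) (x : reg) (n : int) : state V :=
  let: St v a b y := s in
  match x with RA => St v n b y | RB => St v a n y | RY => St v a b n end.

Inductive cond (V : Type) :=
  | InV (p : pred V)
  | GeR (x y : reg)
  | Nz (x : reg).

Definition holds V (b : cond V) (s : state V) : bool :=
  match b with
  | InV p => p (sv s)
  | GeR x y => (get s y <= get s x)%R
  | Nz x => get s x != 0%R
  end.

(* [MI] indexes the available multipliers: which constant multiplications can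
   be done in place depends on whether there is a scratch register. *)
Inductive block (MI V : Type) :=
  | Skip
  | AddR (x y : reg)
  | SubR (x y : reg)
  | IncC (x : reg) (c : int)
  | SetC (x : reg) (c : int)
  | Mul (m : MI) (x : reg)
  | Upd (g : V -> V)
  | Seq (p q : block MI V)
  | Ite (b : cond V) (p q : block MI V).

Arguments Skip {MI V}.
Arguments AddR {MI V}.
Arguments SubR {MI V}.
Arguments IncC {MI V}.
Arguments SetC {MI V}.
Arguments Mul {MI V}.
Arguments InV {V}.
Arguments GeR {V}.
Arguments Nz {V}.
Arguments Upd {MI V}.

Notation "p ;; q" := (Seq p q) (at level 60, right associativity).

Fixpoint ev MI V (mv : MI -> nat) (p : block MI V) (s : state V) : state V :=
  match p with
  | Skip => s
  | AddR x y => set s x (get s x + get s y)%R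
  | SubR x y => set s x (get s x - get s y)%R
  | IncC x c => set s x (get s x + c)%R
  | SetC x c => set s x c
  | Mul m x => set s x ((mv m)%:Z * get s x)%R
  | Upd g => St (g (sv s)) (sa s) (sb s) (sy s)
  | Seq p q => ev mv q (ev mv p s)
  | Ite b p q => if holds b s then ev mv p s else ev mv q s
  end.

(** Loops are kept out of blocks and are never nested. A block then costs a constant, and up to a
    constant factor the running time is the number of loop iterations, which is what [irun]
    counts. *)
Inductive item (MI V : Type) :=
  | Blk (p : block MI V)
  | While (b : cond V) (p : block MI V).

Arguments Blk {MI V}.
Arguments While {MI V}.

Fixpoint loops MI V (mv : MI -> nat) (b : cond V) (p : block MI V)
    (n : nat) (s s' : state V) : Prop :=
  if n is n'.+1 then holds b s /\ loops mv b p n' (ev mv p s) s'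
  else ~~ holds b s /\ s' = s.

Inductive irun MI V (mv : MI -> nat) :
    seq (item MI V) -> state V -> nat -> state V -> Prop :=
  | irun_nil s : irun mv [::] s 0 s
  | irun_blk p l s n s' :
      irun mv l (ev mv p s) n s' -> irun mv (Blk p :: l) s n s'
  | irun_while b p l s m s1 n s' :
      loops mv b p m s s1 -> irun mv l s1 n s' ->
      irun mv (While b p :: l) s (m + n) s'.

(** * Compilation to register-machine code *)

Definition is_assign k V (c : command k V) : bool :=
  match c with
  | Add _ _ _ | AddC _ _ _ | Defs.Sub _ _ _ | Const _ _ => true
  | _ => false
  end.

Definition assign k V (r : {ffun 'I_k -> int}) (c : command k V) :
    {ffun 'I_k -> int} :=
  match c with
  | Add x y z => upd r x (r y + r z)%R
  | AddC x y a => upd r x (r y + a)%R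
  | Defs.Sub x y z => upd r x (r y - r z)%R
  | Const x a => upd r x a
  | _ => r
  end.

(** Registers outside the image of [emb] are unconstrained, which leaves room for a scratch
    register. *)
Definition agrees V k (emb : reg -> 'I_k) (r : {ffun 'I_k -> int})
    (s : state V) : Prop :=
  forall z, r (emb z) = get s z.

Lemma agrees_set V k (emb : reg -> 'I_k) (r r' : {ffun 'I_k -> int})
    (s : state V) x n :
  injective emb ->
  (forall z, r' (emb z) = if emb z == emb x then n else r (emb z)) ->
  agrees emb r s -> agrees emb r' (set s x n).
Proof.
move=> emb_inj r'E rs z; rewrite r'E; case: eqP => [/emb_inj ->|ne].
  by case: s x {rs r'E} => v a b y [].
by rewrite rs; case: s x z ne {rs r'E} => v a b y [] [] // /(_ erefl).
Qed.

Definition implements_mul k V MI (mv : MI -> nat) (emb : reg -> 'I_k)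
    (mulc : MI -> 'I_k -> seq (command k V)) : Prop :=
  forall m x, all (@is_assign k V) (mulc m (emb x)) /\
    forall r (s : state V), agrees emb r s ->
      agrees emb (foldl (@assign k V) r (mulc m (emb x)))
        (set s x ((mv m)%:Z * get s x)%R).

Section Compiler.

Variables (k : nat) (V : finType) (MI : Type) (mv : MI -> nat).
Variables (emb : reg -> 'I_k) (mulc : MI -> 'I_k -> seq (command k V)).
Hypothesis emb_inj : injective emb.
Hypothesis mulcP : implements_mul mv emb mulc.

Definition jump_if (b : cond V) (l : nat) : command k V :=
  match b with
  | InV p => FinIf k [set v | p v] l
  | GeR x y => If V (emb x) CGe (emb y) l
  | Nz x => IfC V (emb x) CNe 0%R l
  end.

Fixpoint bsize (p : block MI V) : nat :=
  match p with
  | Skip => 0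
  | Mul m x => size (mulc m (emb x))
  | Seq p q => bsize p + bsize q
  | Ite b p q => bsize q + bsize p + 2
  | _ => 1
  end.

(** Jump targets are absolute, so the code depends on the line [o] where it is placed. In a
    conditional [q] comes first, because [jump_if] jumps when the test succeeds. *)
Fixpoint code (o : nat) (p : block MI V) : seq (command k V) :=
  match p with
  | Skip => [::]
  | AddR x y => [:: Add V (emb x) (emb x) (emb y)]
  | SubR x y => [:: Defs.Sub V (emb x) (emb x) (emb y)]
  | IncC x c => [:: AddC V (emb x) (emb x) c]
  | SetC x c => [:: Const V (emb x) c]
  | Mul m x => mulc m (emb x)
  | Upd g => [:: Defs.FinSet k [ffun v => g v]]
  | Seq p q => code o p ++ code (o + bsize p) q
  | Ite b p q =>
      [:: jump_if b (o + (bsize q + 2))] ++ code o.+1 q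
        ++ [:: Goto k V (o + (bsize q + bsize p + 2))]
        ++ code (o + (bsize q + 2)) p
  end.

Definition isize (i : item MI V) : nat :=
  match i with Blk p => bsize p | While b p => bsize p + 3 end.

Definition icode (o : nat) (i : item MI V) : seq (command k V) :=
  match i with
  | Blk p => code o p
  | While b p =>
      [:: jump_if b (o + 2); Goto k V (o + (bsize p + 3))]
        ++ code (o + 2) p ++ [:: Goto k V o]
  end.

Fixpoint iscode (o : nat) (l : seq (item MI V)) : seq (command k V) :=
  if l is i :: l' then icode o i ++ iscode (o + isize i) l' else [::].

Definition issize (l : seq (item MI V)) : nat := sumn (map isize l).

Lemma size_code p o : size (code o p) = bsize p.
Proof.
elim: p o => //= [p IHp q IHq|b p IHp q IHq] o.
  by rewrite size_cat IHp IHq.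
by rewrite size_cat /= IHp IHq; lia.
Qed.

Lemma size_icode o i : size (icode o i) = isize i.
Proof. by case: i => [p|b p] /=; rewrite ?size_cat size_code //= ; lia. Qed.

Lemma size_iscode o l : size (iscode o l) = issize l.
Proof.
by elim: l o => //= i l IHl o; rewrite size_cat size_icode IHl.
Qed.

Section Execution.

Variables (v0 : V) (cs : seq (command k V)).
Let P := Program v0 cs.

Definition occurs (o : nat) (l : seq (command k V)) : Prop :=
  exists pre post, cs = pre ++ l ++ post /\ size pre = o.

Lemma occurs_cat o l1 l2 :
  occurs o (l1 ++ l2) -> occurs o l1 /\ occurs (o + size l1) l2.
Proof.
move=> [pre [post [e <-]]].
split; first by exists pre, (l2 ++ post); rewrite e !catA.
by exists (pre ++ l1), post; rewrite size_cat e !catA.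
Qed.

Lemma occurs_onth o c l : occurs o (c :: l) -> onth cs o = Some c.
Proof. by case=> pre [post [e <-]]; rewrite e onth_cat ltnn subnn. Qed.

Definition goes (o : nat) (s : state V) (t o' : nat) (s' : state V) : Prop :=
  forall r inp out, agrees emb r s -> exists t' r',
    [/\ t' <= t, agrees emb r' s' &
     run (@rm_step k P) t' (@RMConfig k P o r (sv s) inp out) =
       Some (@RMConfig k P o' r' (sv s') inp out)].

Lemma goes_refl o s : goes o s 0 o s.
Proof. by move=> r inp out rs; exists 0, r. Qed.

Lemma goes_trans o1 s1 t1 o2 s2 t2 o3 s3 :
  goes o1 s1 t1 o2 s2 -> goes o2 s2 t2 o3 s3 -> goes o1 s1 (t1 + t2) o3 s3.
Proof.
move=> g1 g2 r inp out /(g1 r inp out)[u1 [r1 [le1 a1 e1]]].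
have [u2 [r2 [le2 a2 e2]]] := g2 r1 inp out a1.
exists (u1 + u2), r2; split=> //; first exact: leq_add.
by rewrite run_add e1.
Qed.

Lemma goes_le o s t t' o' s' : t <= t' -> goes o s t o' s' -> goes o s t' o' s'.
Proof.
move=> le_t g r inp out /(g r inp out)[u [r1 [le1 a1 e1]]].
by exists u, r1; split=> //; apply: leq_trans le_t.
Qed.

Lemma goes_goto o l s : occurs o [:: Goto k V l] -> goes o s 1 l s.
Proof.
move=> /occurs_onth e r inp out rs; exists 1, r; split=> //=.
by rewrite /rm_step /= e.
Qed.

Lemma goes_jump_if b o l s : occurs o [:: jump_if b l] ->
  goes o s 1 (if holds b s then l else o.+1) s.
Proof.
move=> /occurs_onth e r inp out rs; exists 1, r; split=> //=.
by rewrite /rm_step /= e; case: b {e} => [p|x y|x] /=; rewrite ?inE ?rs.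
Qed.

Lemma run_assigns l o r v inp out : all (@is_assign k V) l -> occurs o l ->
  run (@rm_step k P) (size l) (@RMConfig k P o r v inp out) =
    Some (@RMConfig k P (o + size l) (foldl (@assign k V) r l) v inp out).
Proof.
elim: l o r => [|c l IHl] o r /=; first by rewrite addn0.
move=> /andP[ac al] /[dup] /occurs_onth e; rewrite -cat1s.
case/occurs_cat=> _ ol; rewrite /rm_step /= e addnS -addSn -addn1.
by clear -IHl ac al ol; case: c ac ol => //= *; rewrite addn1 IHl // -addn1.
Qed.

Lemma upd_agrees r (s : state V) x n :
  agrees emb r s -> agrees emb (upd r (emb x) n) (set s x n).
Proof. by move=> rs; apply: agrees_set rs => // z; rewrite ffunE. Qed.

Lemma sv_set (s : state V) x n : sv (set s x n) = sv s.
Proof. by case: s x => v a b y []. Qed.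

(** Block code only jumps forward, so each line is executed at most once and the length of the code
    bounds the time. *)
Lemma goes_code p o s :
  occurs o (code o p) -> goes o s (bsize p) (o + bsize p) (ev mv p s).
Proof.
elim: p o s => /=.
- by move=> o s _; rewrite addn0; apply: goes_refl.
- move=> x y o s oc r inp out rs.
  exists 1, (upd r (emb x) (get s x + get s y)%R); split=> //.
    exact: upd_agrees.
  by rewrite (run_assigns _ _ _ _ _ oc) //= sv_set !rs.
- move=> x y o s oc r inp out rs.
  exists 1, (upd r (emb x) (get s x - get s y)%R); split=> //.
    exact: upd_agrees.
  by rewrite (run_assigns _ _ _ _ _ oc) //= sv_set !rs.
- move=> x c o s oc r inp out rs.
  exists 1, (upd r (emb x) (get s x + c)%R); split=> //.
    exact: upd_agrees.
  by rewrite (run_assigns _ _ _ _ _ oc) //= sv_set !rs.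
- move=> x c o s oc r inp out rs.
  exists 1, (upd r (emb x) c); split=> //; first exact: upd_agrees.
  by rewrite (run_assigns _ _ _ _ _ oc) //= sv_set.
- move=> m x o s oc r inp out rs; have [al mP] := mulcP m x.
  exists (size (mulc m (emb x))), (foldl (@assign k V) r (mulc m (emb x))).
  by split=> //; [exact: mP | rewrite run_assigns // sv_set].
- move=> g o s /occurs_onth oc r inp out rs; exists 1, r; split=> //=.
  by rewrite /rm_step /= oc /= ffunE addn1.
- move=> p IHp q IHq o s; case/occurs_cat; rewrite size_code => op oq.
  by rewrite addnA; apply: goes_trans (IHp _ _ op) (IHq _ _ oq).
- move=> b p IHp q IHq o s; rewrite -cat1s => /occurs_cat[ob].
  case/occurs_cat; rewrite /= addn1 size_code => oq; rewrite -cat1s.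
  case/occurs_cat=> og /=.
  have -> : o.+1 + bsize q + 1 = o + (bsize q + 2) by lia.
  move=> op.
  have := goes_jump_if (s := s) ob; case: ifP => _ gb.
    have := goes_trans gb (IHp _ s op).
    by rewrite [o + _ + _](_ : _ = o + (bsize q + bsize p + 2));
      [apply: goes_le; lia | lia].
  have := goes_trans gb (goes_trans (IHq _ s oq) (goes_goto og)).
  by apply: goes_le; lia.
Qed.

(** A round costs the test, the body and the jump back; the extra round in [n.+1] pays for the
    failing test and the exit. *)
Lemma goes_loops b p n s s' o :
  loops mv b p n s s' -> occurs o (icode o (While b p)) ->
  goes o s ((bsize p + 3) * n.+1) (o + (bsize p + 3)) s'.
Proof.
move=> + oc; move: (oc) => /occurs_cat[].
rewrite -cat1s => /occurs_cat[ob og] /= /occurs_cat[op].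
rewrite size_code => oe; rewrite addn1 in og.
elim: n s => [|n IHn] s /= [bs].
  have := goes_jump_if (s := s) ob; rewrite (negbTE bs) => gb ->.
  by apply: goes_le (goes_trans gb (goes_goto og)); lia.
move=> /IHn gn; have := goes_jump_if (s := s) ob; rewrite bs => gb.
apply: goes_le (goes_trans gb (goes_trans (goes_code op)
  (goes_trans (goes_goto oe) gn))).
by lia.
Qed.

Lemma goes_items l s n s' o D :
  irun mv l s n s' -> occurs o (iscode o l) -> issize l <= D ->
  goes o s (D * (n + size l)) (o + issize l) s'.
Proof.
move=> H; elim: H o => {l s n s'}
  [s|p l s n s' _ IH|b p l s m s1 n s' lo _ IH] o.
- by move=> _ _; rewrite muln0 addn0; apply: goes_refl.
- rewrite /= => /occurs_cat[op]; rewrite size_code => ol.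
  rewrite /issize /= -/(issize l) => leD; rewrite addnA.
  apply: goes_le (goes_trans (goes_code op) (IH _ ol _)); nia.
- case/occurs_cat=> ow; rewrite size_icode => ol.
  rewrite /issize /= -/(issize l) => leD; rewrite addnA.
  apply: goes_le (goes_trans (goes_loops lo ow) (IH _ ol _)); nia.
Qed.

End Execution.

Lemma compile_correct (v0 : V) (l : seq (item MI V)) :
  exists (P : program k) (C : nat), forall x y n s,
    irun mv l (St v0 (Posz x) 0%R 0%R) n s -> sb s = Posz y ->
    rm_computes_within P x y (C * n.+1).
Proof.
set cs := Read V (emb RA) :: iscode 1 l ++ [:: Write V (emb RB)].
(* Here [n + size l <= (size l).+1 * n.+1], and the 2 pays for the read and the write. *)
exists (Program v0 cs), (issize l * (size l).+1 + 2) => x y n s ir sy_.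
have ol : occurs cs 1 (iscode 1 l).
  by exists [:: Read V (emb RA)], [:: Write V (emb RB)].
set r0 : {ffun 'I_k -> int} := upd [ffun=> 0%R] (emb RA) (Posz x).
have [|t [r [let_ ar e]]] :=
  @goes_items v0 cs _ _ _ _ _ _ ir ol (leqnn _) r0 [::] [::].
  by apply: (@upd_agrees _ (St v0 0%R 0%R 0%R)) => -[]; rewrite ffunE.
exists (1 + (t + 1)),
  (@RMConfig k (Program v0 cs) (size cs) r (sv s) [::] [:: Posz y]).
split=> //; first by nia.
rewrite run_add /= /rm_step /= run_add e /= /rm_step /=.
rewrite add1n /= onth_cat size_iscode ltnn subnn /= ar /= sy_.
by rewrite /cs /= size_cat size_iscode addn1.
Qed.

End Compiler.

(** * Digit strings as fractions *)

Definition horner (c : nat) (ds : seq nat) : nat :=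
  foldl (fun n d => c * n + d) 0 ds.

(* [x / y] is the fraction with base-[c] digits [ds] after the point. *)
Fixpoint frac (c : nat) (y x : int) (ds : seq nat) : Prop :=
  if ds is d :: ds' then
    exists x' : int, (c%:Z * x = d%:Z * y + x')%R /\ frac c y x' ds'
  else x = 0%R.

Section Fractions.

Variable c : nat.

(** The factor [b] may differ from the base [c]: while the input is read, its base-[i] fraction is
    rescaled by the tape base. *)
Lemma frac_scale b (y x : int) ds :
  frac c y x ds -> frac c (b%:Z * y)%R (b%:Z * x)%R ds.
Proof.
elim: ds x => [|d ds IHds] x /=; first by move=> ->; rewrite mulr0.
case=> x' [e /IHds fx]; exists (b%:Z * x')%R; split=> //.
by rewrite mulrCA e mulrDr mulrCA.
Qed.

Lemma frac_push d (y x : int) ds :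
  frac c y x ds -> frac c (c%:Z * y)%R (x + d%:Z * y)%R (d :: ds).
Proof.
move=> fx; exists (c%:Z * x)%R; split; last exact: frac_scale.
by rewrite mulrDr mulrCA addrC.
Qed.

(** The default 0 of [head] matters: an empty stack yields 0 forever, like the blank ends of the
    tape. *)
Lemma frac_pop (y x : int) ds : frac c y x ds -> exists x' : int,
  (c%:Z * x = (head 0%N ds)%:Z * y + x')%R /\ frac c y x' (behead ds).
Proof. by case: ds => [|d ds] //= ->; exists 0%R; rewrite mulr0 mul0r. Qed.

(** Inductively [x' < y], so [c x = d y + x' < (d + 1) y <= c y]. Applied to the remainder of a pop,
    the bound makes the digit the integer quotient that repeated subtraction finds. *)
Lemma frac_bounds (y x : int) ds : all (gtn c) ds -> (0 < y)%R ->
  frac c y x ds -> (0 <= x < y)%R.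
Proof.
move=> + y0; elim: ds x => [|d ds IHds] x /=.
  by move=> _ ->; rewrite lexx.
move=> /andP[dc ads] [x' [e /(IHds _ ads)/andP[x0 xy]]].
have c0 : (0 < c%:Z)%R by lia.
have dy : (0 <= d%:Z * y)%R by rewrite mulr_ge0 // ltW.
have dcy : ((d%:Z + 1) * y <= c%:Z * y)%R by rewrite ler_pM2r //; lia.
by rewrite -(pmulr_rge0 _ c0) -(ltr_pM2l c0) e; lia.
Qed.

(** Together with [frac_zeros] this turns the test of a numerator against 0 into a test that only
    zero digits remain. *)
Lemma frac0 (y : int) ds : all (gtn c) ds -> (0 < y)%R ->
  frac c y 0%R ds -> all (pred1 0) ds.
Proof.
move=> + y0; elim: ds => //= d ds IHds /andP[dc ads] [x' [e fx]].
have /andP[x0 _] := frac_bounds ads y0 fx.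
have dy : (0 <= d%:Z * y)%R by rewrite mulr_ge0 // ltW.
have x'0 : x' = 0%R by lia.
move: fx; rewrite x'0 => /(IHds ads) ->; rewrite andbT.
have /eqP : (d%:Z * y = 0)%R by lia.
by rewrite mulf_eq0 (gt_eqF y0) orbF.
Qed.

Lemma frac_zeros (y x : int) ds : 0 < c -> all (pred1 0) ds ->
  frac c y x ds -> x = 0%R.
Proof.
move=> c0; elim: ds x => //= d ds IHds x.
move=> /andP[/eqP-> /IHds fx] [x' [e /fx x'0]].
move: e; rewrite x'0 mul0r addr0 => /eqP.
by rewrite mulf_eq0 => /orP[|/eqP//]; lia.
Qed.

Lemma foldl_horner n ds :
  foldl (fun n d => c * n + d) n ds = n * c ^ size ds + horner c ds.
Proof.
rewrite /horner; elim: ds n => [|d ds IHds] n /=.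
  by rewrite muln1 addn0.
rewrite IHds [in RHS]IHds muln0 add0n expnS; nia.
Qed.

(** The factor [w] carries the induction: dropping the first digit keeps the denominator and
    replaces [w] by [c * w]. *)
Lemma frac_horner (w : nat) ds :
  frac c (Posz (c ^ size ds * w)) (Posz (w * horner c ds)) ds.
Proof.
elim: ds w => [|d ds IHds] w /=; first by rewrite muln0.
exists (Posz (c * w * horner c ds)); split.
  rewrite /horner /= foldl_horner muln0 add0n -/(horner c ds) expnS; nia.
by rewrite expnS mulnC mulnA [w * c]mulnC mulnC; apply: IHds.
Qed.

End Fractions.

(** * Digits of a natural number *)

Section Digits.

Variable b : nat.
Hypothesis b_gt1 : 1 < b.

(** The clause on powers allows the length to be found by comparisons alone. It starts at [e = 1]
    because 0 has one digit. *)
Lemma digits_recP fuel n : n < fuel ->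
  [/\ all (gtn b) (digits_rec b fuel n), horner b (digits_rec b fuel n) = n &
     forall e, 0 < e -> (b ^ e <= n) = (e < size (digits_rec b fuel n))].
Proof.
elim: fuel n => //= fuel IH n; rewrite ltnS => lenf.
case: ltnP => [nb|bn].
  split; rewrite /= ?nb // ?/horner /= ?muln0 // => e e0.
  rewrite ltnS [RHS]leqNgt e0 leqNgt; apply: negbF; apply: leq_trans nb _.
  by rewrite -{1}(expn1 b) leq_exp2l.
have b0 : 0 < b by exact: ltnW.
have [|al hn se] := IH (n %/ b).
  by apply: leq_trans (ltn_Pdiv b_gt1 _) lenf; exact: leq_trans bn.
split; first by rewrite all_rcons /= ltn_mod b0.
  by rewrite /horner -cats1 foldl_cat /= -/(horner _ _) hn mulnC -divn_eq.
case=> // -[|e] _; rewrite size_rcons.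
  rewrite expn1 bn ltnS; apply/esym; case: (fuel) lenf => [|g] /=.
    by rewrite leqn0 => /eqP n0; move: bn; rewrite n0; case: (b) b0.
  by case: ifP => // _ _; rewrite size_rcons.
by rewrite ltnS -se // expnSr leq_divRL.
Qed.

Lemma digits_lt n : all (gtn b) (digits b n).
Proof. by have [] := digits_recP (ltnSn n). Qed.

Lemma horner_digits n : horner b (digits b n) = n.
Proof. by have [] := digits_recP (ltnSn n). Qed.

Lemma size_digits n e : 0 < e -> (b ^ e <= n) = (e < size (digits b n)).
Proof. by have [_ _] := digits_recP (ltnSn n); apply. Qed.

Lemma size_digits_gt0 n : 0 < size (digits b n).
Proof. by rewrite /digits /=; case: ifP => //; rewrite size_rcons. Qed.

End Digits.

(** * Stack operations *)

Section Stacks.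

Variables (Q : finType) (N : nat) (MI : Type) (mv : MI -> nat).

Local Notation V := (Q * 'I_N.+1)%type.
Implicit Types (s : state V) (p : block MI V).

Definition set_digit (d : nat) (v : V) : V := (v.1, inord d).

(** The subtraction loop is unrolled, so that popping remains a block of constant cost. *)
Fixpoint extract (n : nat) (x : reg) : block MI V :=
  if n is n'.+1 then
    Ite (GeR x RY) (SubR x RY ;; Upd (fun v : V => set_digit v.2.+1 v)) Skip
      ;; extract n' x
  else Skip.

Definition pop (m : MI) (x : reg) : block MI V :=
  Upd (set_digit 0) ;; Mul m x ;; extract (mv m) x.

(** The copy guarded by [n'] runs exactly when the digit exceeds [n']; if [p] preserves the digit,
    [p] is thus repeated as often as the digit says, up to [n]. *)
Fixpoint digit_times (n : nat) (p : block MI V) : block MI V :=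
  if n is n'.+1 then
    digit_times n' p ;; Ite (InV (fun v : V => n' < v.2)) p Skip
  else Skip.

Definition push (m : MI) (x z : reg) : block MI V :=
  digit_times N (AddR x RY) ;; Mul m z ;; Mul m RY.

Lemma ev_Seq p1 p2 s : ev mv (p1 ;; p2) s = ev mv p2 (ev mv p1 s).
Proof. by []. Qed.

Lemma ev_set_digit (g : nat -> nat) q d a b y : d <= N ->
  ev mv (Upd (fun v : V => set_digit (g v.2) v)) (St (q, inord d) a b y) =
    St (q, inord (g d)) a b y.
Proof. by move=> dN; rewrite /= /set_digit /= inordK. Qed.

Lemma ev_extract n x q e d a b (y r : int) :
  x <> RY -> get (St (q, inord e : 'I_N.+1) a b y) x = (d%:Z * y + r)%R ->
  (0 <= r < y)%R -> d <= n -> e + d <= N ->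
  ev mv (extract n x) (St (q, inord e) a b y) =
    set (St (q, inord (e + d)) a b y) x r.
Proof.
move=> + + /andP[r0 ry]; case: x => // _;
  [elim: n e d a => [|n IHn] e [|d] a | elim: n e d b => [|n IHn] e [|d] b];
  rewrite //= => -> len lee; rewrite ?mul0r ?add0r ?addn0 //.
1,3: by rewrite leNgt ry /= (IHn _ 0) ?addn0 ?mul0r ?add0r // -(addn0 e).
all: have dy : (0 <= d%:Z * y)%R by rewrite mulr_ge0 //; lia.
all: have eS : (d.+1%:Z * y = d%:Z * y + y)%R
  by rewrite -[d.+1]addn1 PoszD mulrDl mul1r.
all: rewrite ifT ?eS; last by lia.
all: by rewrite /= inordK ?(IHn _ d) ?addnS ?addSn //=; lia.
Qed.

Lemma ev_popA m v d (a b y r : int) :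
  ((mv m)%:Z * a = d%:Z * y + r)%R -> (0 <= r < y)%R -> d <= mv m -> d <= N ->
  ev mv (pop m RA) (St v a b y) = St (v.1, inord d) r b y.
Proof. by move=> e ry dm dN; rewrite /= (@ev_extract _ RA _ _ d _ _ _ r). Qed.

Lemma ev_popB m v d (a b y r : int) :
  ((mv m)%:Z * b = d%:Z * y + r)%R -> (0 <= r < y)%R -> d <= mv m -> d <= N ->
  ev mv (pop m RB) (St v a b y) = St (v.1, inord d) a r y.
Proof. by move=> e ry dm dN; rewrite /= (@ev_extract _ RB _ _ d _ _ _ r). Qed.

Lemma ev_digit_times n p s : (forall s, sv (ev mv p s) = sv s) ->
  ev mv (digit_times n p) s = iter (minn n (sv s).2) (ev mv p) s.
Proof.
move=> pP; have iterP k : sv (iter k (ev mv p) s) = sv s.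
  by elim: k => //= k IHk; rewrite pP.
elim: n => [|n IHn] /=; first by rewrite min0n.
rewrite IHn iterP; case: ifP => [le_n|/negbT]; last rewrite -leqNgt => le_n.
  by rewrite (minn_idPl (ltnW le_n)) (minn_idPl le_n).
by rewrite (minn_idPr le_n) (minn_idPr (leqW le_n)).
Qed.

Lemma iter_AddR n x s : x <> RY ->
  iter n (ev mv (AddR x RY)) s = set s x (get s x + n%:Z * sy s)%R.
Proof.
case: s x => v a b y [] // _; elim: n => [|n /= ->] /=;
  rewrite ?mul0r ?addr0 // -[n.+1]addn1 PoszD mulrDl mul1r addrA //.
Qed.

Lemma iter_IncC n (c : int) s :
  iter n (ev mv (IncC RB c)) s = set s RB (sb s + n%:Z * c)%R.
Proof.
case: s => v a b y; elim: n => [|n /= ->] /=;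
  by rewrite ?mul0r ?addr0 // -[n.+1]addn1 PoszD mulrDl mul1r addrA.
Qed.

Lemma ev_pushA m q d a b y : d <= N ->
  ev mv (push m RA RB) (St (q, inord d) a b y) =
    St (q, inord d) (a + d%:Z * y)%R ((mv m)%:Z * b)%R ((mv m)%:Z * y)%R.
Proof.
move=> dN; rewrite [LHS]/= ev_digit_times => [|[v {}a {}b {}y]] //.
by rewrite /= inordK // (minn_idPr dN) iter_AddR.
Qed.

Lemma ev_pushB m q d a b y : d <= N ->
  ev mv (push m RB RA) (St (q, inord d) a b y) =
    St (q, inord d) ((mv m)%:Z * a)%R (b + d%:Z * y)%R ((mv m)%:Z * y)%R.
Proof.
move=> dN; rewrite [LHS]/= ev_digit_times => [|[v {}a {}b {}y]] //.
by rewrite /= inordK // (minn_idPr dN) iter_AddR.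
Qed.

End Stacks.

Arguments pop {Q N MI} mv m x.
Arguments push {Q N MI} m x z.

(** * The simulation *)

Section Simulation.

Variables (i j : nat) (M : tm i j) (MI : Type) (mv : MI -> nat).
Variables mi mj mb : MI.
Hypotheses (mvi : mv mi = i) (mvj : mv mj = j).
Hypotheses (i_gt1 : 1 < i) (j_gt1 : 1 < j).
Hypothesis mvb : #|tm_symbol M| < mv mb.

Local Notation blank := (tm_blank M).
Local Notation B := (mv mb).
(** One finite variable holds in turn symbol codes below [B], input digits below [i] and output
    digits below [j]. *)
Local Notation N := (B + i + j).
Local Notation V := (tm_state M * 'I_N.+1)%type.

(** The blank is coded by 0, the digit popped from an empty stack, so unlisted cells need no special
    treatment. *)
Definition symn (s : tm_symbol M) : nat :=
  if s == blank then 0 else (enum_rank s).+1.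

Definition nsym (d : nat) : tm_symbol M := odflt blank [pick s | symn s == d].

Definition undout (s : tm_symbol M) : nat :=
  odflt 0 (omap val [pick d : 'I_j | tm_dout M d == s]).

Definition tm_act (v : V) := tm_delta v.1 (nsym v.2).

Definition dir_is (m : move) (v : V) : bool :=
  match tm_act v, m with
  | Some (_, _, MoveL), MoveL | Some (_, _, MoveR), MoveR => true
  | _, _ => false
  end.

Definition write_head (v : V) : V :=
  if tm_act v is Some (q, s, _) then (q, inord (symn s)) else v.

(** During a rewind the variable is only in transit: [RA] also contains the scanned cell, and the
    digit held before is overwritten. *)
Definition move_left : block MI V := pop mv mb RB ;; push mb RA RB.

(** The direction is tested before [write_head] overwrites the state and symbol that determine
    it. *)
Definition simulate_step : block MI V :=
  Ite (InV (dir_is MoveR)) (Upd write_head ;; push mb RB RA ;; pop mv mb RA)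
    (Ite (InV (dir_is MoveL)) (Upd write_head ;; push mb RA RB ;; pop mv mb RB)
      (Upd write_head)).

(** The digit pushed was popped one round earlier. At the end the marker is therefore in the
    variable and not on the tape. *)
Definition input_step : block MI V :=
  Upd (fun v : V => set_digit (symn (tm_din M v.2)) v) ;; push mb RB RA
    ;; pop mv mi RA.

(** After the rewind [RB] is 0 and [RY] no longer changes, so [RB] is free to accumulate the result.
    Blanks are skipped. *)
Definition output_step : block MI V :=
  pop mv mb RA ;;
  Ite (InV (fun v : V => 0 < v.2))
    (Upd (fun v : V => set_digit (undout (nsym v.2)) v) ;; Mul mj RB
      ;; digit_times N (IncC RB 1%R))
    Skip.

(* The digit 1 appended to the input marks its end: without it trailing zeros
   of the input would be lost. *)
Definition simulator : seq (item MI V) :=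
  [:: Blk (SetC RY i);
      While (GeR RA RY) (Mul mi RY);
      Blk (Mul mi RA ;; IncC RA 1%R ;; Mul mi RY);
      Blk (pop mv mi RA);
      While (Nz RA) input_step;
      Blk (Upd (fun _ => (tm_start M, inord 0)));
      While (Nz RB) move_left;
      Blk (pop mv mb RA);
      While (InV (fun v : V => tm_act v)) simulate_step;
      Blk (push mb RA RB);
      While (Nz RB) move_left;
      While (Nz RA) output_step].

(** * Coding of tape symbols *)

Lemma symn_inj : injective symn.
Proof.
move=> s t; rewrite /symn; case: eqP => [->|_]; case: eqP => [->|_] //.
by case=> /val_inj/enum_rank_inj.
Qed.

Lemma symn_blank : symn blank = 0.
Proof. by rewrite /symn eqxx. Qed.

Lemma symn_eq0 s : (symn s == 0) = (s == blank).
Proof. by rewrite -symn_blank (inj_eq symn_inj). Qed.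

Lemma symn_lt s : symn s < B.
Proof.
rewrite /symn; case: eqP => _; first exact: leq_trans mvb.
by apply: leq_trans mvb; rewrite ltnS ltn_ord.
Qed.

Lemma symn_le s : symn s <= N.
Proof. by have := symn_lt s; lia. Qed.

Lemma symnK : cancel symn nsym.
Proof.
move=> s; rewrite /nsym; case: pickP => [t /eqP/symn_inj //|/(_ s)].
by rewrite eqxx.
Qed.

Lemma undoutK d : d < j -> undout (tm_dout M d) = d.
Proof.
move=> dj; rewrite /undout; case: pickP => [e /eqP /= /tm_dout_inj|].
  by apply; rewrite ?inE.
by move/(_ (Ordinal dj)); rewrite eqxx.
Qed.

Lemma undout_le s : undout s <= N.
Proof.
rewrite /undout; case: pickP => //= e _; have := ltn_ord e; lia.
Qed.

Lemma all_symn_lt l : all (gtn B) (map symn l).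
Proof. by apply/allP => _ /mapP[s _ ->]; apply: symn_lt. Qed.

Lemma head_symn r : head 0 (map symn r) = symn (head blank r).
Proof. by case: r => //=; rewrite symn_blank. Qed.

Lemma frac_eq0 (y x : int) r : (0 < y)%R -> frac B y x (map symn r) ->
  (x == 0%R) = all (pred1 blank) r.
Proof.
move=> y0 fx; have -> : all (pred1 blank) r = all (pred1 0) (map symn r).
  by rewrite all_map; apply: eq_all => s /=; rewrite symn_eq0.
apply/eqP/idP => [x0|z]; last by apply: frac_zeros z fx; apply: leq_trans mvb.
by apply: frac0 (all_symn_lt r) y0 _; rewrite -x0.
Qed.

(* The scanned symbol is held by the finite variable, so [r] lists the cells
   strictly to the right of the head. *)
Definition tape q (x : tm_symbol M) l r (s : state V) : Prop :=
  exists a b y : int,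
    [/\ s = St (q, inord (symn x)) a b y, (0 < y)%R,
        frac B y b (map symn l) & frac B y a (map symn r)].

(** * Tape operations, rewinding and Turing steps *)

Lemma tape_popA q x l r s : tape q x l r s ->
  tape q (head blank r) l (behead r) (ev mv (pop mv mb RA) s).
Proof.
move=> [a [b [y [-> y0 fb /frac_pop[a' []]]]]].
rewrite head_symn behead_map => e fa.
have bd := frac_bounds (all_symn_lt _) y0 fa.
rewrite (ev_popA _ _ e bd) ?symn_le ?(ltnW (symn_lt _)) //.
by exists a', b, y.
Qed.

Lemma tape_popB q x l r s : tape q x l r s ->
  tape q (head blank l) (behead l) r (ev mv (pop mv mb RB) s).
Proof.
move=> [a [b [y [-> y0 /frac_pop[b' []]]]]].
rewrite head_symn behead_map => e fb fa.
have bd := frac_bounds (all_symn_lt _) y0 fb.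
rewrite (ev_popB _ _ e bd) ?symn_le ?(ltnW (symn_lt _)) //.
by exists a, b', y.
Qed.

Lemma mvb_gt0 : (0 < B%:Z)%R.
Proof. by have := mvb; lia. Qed.

Lemma tape_pushA q x l r s : tape q x l r s ->
  tape q x l (x :: r) (ev mv (push mb RA RB) s).
Proof.
move=> [a [b [y [-> y0 fb fa]]]]; rewrite ev_pushA ?symn_le //.
do 3 eexists; split; first reflexivity.
- by rewrite mulr_gt0 ?mvb_gt0.
- exact: frac_scale.
- exact: frac_push.
Qed.

Lemma tape_pushB q x l r s : tape q x l r s ->
  tape q x (x :: l) r (ev mv (push mb RB RA) s).
Proof.
move=> [a [b [y [-> y0 fb fa]]]]; rewrite ev_pushB ?symn_le //.
do 3 eexists; split; first reflexivity.
- by rewrite mulr_gt0 ?mvb_gt0.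
- exact: frac_push.
- exact: frac_scale.
Qed.

Lemma tape_holdsB q x l r s : tape q x l r s ->
  holds (Nz RB) s = ~~ all (pred1 blank) l.
Proof. by move=> [a [b [y [-> y0 fb fa]]]] /=; rewrite (frac_eq0 y0 fb). Qed.

(** The loop stops once the left numerator is 0, which may happen with listed blanks [l'] still
    unmoved. *)
Lemma tape_rewind q x l r s : tape q x l r s -> exists n s' x' l' r',
  [/\ n <= size l, loops mv (Nz RB) move_left n s s', tape q x' [::] r' s',
      all (pred1 blank) l' & rev l' ++ r' = rev l ++ r].
Proof.
elim: l x r s => [|y l IHl] x r s ts.
  exists 0, s, x, [::], r; split=> //; split=> //.
  by rewrite (tape_holdsB ts).
case ly: (all (pred1 blank) (y :: l)).
  exists 0, s, x, (y :: l), r; split=> //.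
    by split=> //; rewrite (tape_holdsB ts) ly.
  (* A stack of blanks has numerator 0, hence it also represents the empty list. *)
  case: ts => a [b [z [-> z0 fb fa]]]; exists a, b, z; split=> //=.
  by apply/eqP; rewrite (frac_eq0 z0 fb).
have [n [s' [x' [l' [r' [le_n lo ts' al e]]]]]] :=
  IHl _ _ _ (tape_pushA (tape_popB ts)).
exists n.+1, s', x', l', r'; split=> //.
  by split=> //; rewrite (tape_holdsB ts) ly.
by rewrite e rev_cons cat_rcons.
Qed.

Definition represents (c : tm_config M) (s : state V) : Prop :=
  tape (tm_ctl c) (head blank (tm_right c)) (tm_left c) (behead (tm_right c)) s.

Lemma tape_act q x l r s : tape q x l r s -> tm_act (sv s) = tm_delta q x.
Proof.
move=> [a [b [y [-> _ _ _]]]].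
by rewrite /tm_act /= inordK ?symnK // ltnS symn_le.
Qed.

Lemma tape_write q x l r s q' x' m : tape q x l r s ->
  tm_delta q x = Some (q', x', m) -> tape q' x' l r (ev mv (Upd write_head) s).
Proof.
move=> ts e; have := tape_act ts; rewrite e.
case: ts => a [b [y [-> y0 fb fa]]] /= ta.
by exists a, b, y; rewrite /= /write_head ta.
Qed.

Lemma represents_step c c' s : represents c s -> tm_step c = Some c' ->
  represents c' (ev mv simulate_step s).
Proof.
case: c => q l r; rewrite /represents /= => ts.
case e: (tm_delta q (head blank r)) => [[[q' x'] m]|] //= [<-].
have ta := tape_act ts; have tw := tape_write ts e.
rewrite /dir_is ta e; case: m {e ta} => /=.
- exact: tape_popB (tape_pushA tw).
- exact: tape_popA (tape_pushB tw).
- exact: tw.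
Qed.

Definition tape_size (c : tm_config M) := size (tm_left c) + size (tm_right c).

(** The worst case is a left move with both lists empty: the written cell and the one entered become
    listed. *)
Lemma tape_size_step c c' : tm_step c = Some c' ->
  tape_size c' <= tape_size c + 2.
Proof.
case: c => q l r /=; case: tm_delta => // [[[q' x] m]] [<-].
rewrite /tape_size; case: m => /=; rewrite !size_behead; lia.
Qed.

Lemma represents_run t c c' s : represents c s ->
  run (@tm_step i j M) t c = Some c' -> tm_step c' = None -> exists s',
  [/\ loops mv (InV (fun v : V => tm_act v)) simulate_step t s s',
      represents c' s' & tape_size c' <= tape_size c + 2 * t].
Proof.
elim: t c s => [|t IHt] c s rs /=.
  move=> [<-] h; exists s; split=> //; last by lia.
  split=> //; rewrite (tape_act rs); case: c h {rs} => q l r /=.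
  by case: tm_delta => // [[[]]].
case e: (tm_step c) => [c1|] //= ru h.
have [s' [lo rs' le]] := IHt _ _ (represents_step rs e) ru h.
exists s'; split=> //; last by have := tape_size_step e; lia.
split=> //; rewrite (tape_act rs); case: c e {rs} => q l r /=.
by case: tm_delta => // [[[]]].
Qed.

(** * Reading the input *)

(** By [size_digits] the first power of [i] above [x], from exponent 1 on, has the number of digits
    as exponent. Starting there also handles the input 0. *)
Lemma scale_loop n e (v : V) x : 0 < e -> e + n = size (digits i x) ->
  loops mv (GeR RA RY) (Mul mi RY) n (St v (Posz x) 0%R (Posz (i ^ e)))
    (St v (Posz x) 0%R (Posz (i ^ size (digits i x)))).
Proof.
elim: n e => [|n IHn] e e0 en /=.
  by rewrite -en addn0 lez_nat size_digits // -en addn0 ltnn.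
split; first by rewrite lez_nat size_digits // -en; lia.
by rewrite mvi -PoszM -expnS; apply: IHn; rewrite // addSn -addnS.
Qed.

Lemma ev_input_step q d (a b y : int) l ds : d <= N -> all (gtn i) ds ->
  (0 < y)%R -> frac i y a ds -> frac B y b (map symn l) ->
  exists a' b' y' : int,
  [/\ ev mv input_step (St (q, inord d) a b y) =
        St (q, inord (head 0 ds)) a' b' y',
      (0 < y')%R, frac i y' a' (behead ds) &
      frac B y' b' (map symn (tm_din M d :: l))].
Proof.
move=> dN ads y0 fa fb.
have By : (0 < B%:Z * y)%R by rewrite mulr_gt0 ?mvb_gt0.
have [a' [ea fa']] := frac_pop (frac_scale B fa).
have ads' : all (gtn i) (behead ds) by case: (ds) ads => //= ? ? /andP[].
have bd := frac_bounds ads' By fa'.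
have hd : head 0 ds < i by case: (ds) ads => [_|? ? /andP[]//]; exact: ltnW.
exists a', (b + (symn (tm_din M d))%:Z * y)%R, (B%:Z * y)%R; split=> //.
  rewrite /input_step ev_Seq (ev_set_digit _ (symn \o tm_din M)) //.
  rewrite ev_Seq ev_pushB ?symn_le //.
  by rewrite -mvi in ea hd; rewrite (ev_popA _ _ ea bd) //; lia.
exact: frac_push.
Qed.

Lemma input_loop ds d q (a b y : int) l : d <= N -> all (gtn i) ds ->
  (0 < y)%R -> frac i y a (rcons ds 1) -> frac B y b (map symn l) ->
  exists (v : V) (b' y' : int),
    [/\ loops mv (Nz RA) input_step (size ds).+1 (St (q, inord d) a b y)
          (St v 0%R b' y'), (0 < y')%R &
        frac B y' b' (map symn (rev (map (tm_din M) (d :: ds)) ++ l))].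
Proof.
(* The final digit 1 keeps the numerator nonzero, so the loop cannot stop early. *)
have nza ds' y' a' : all (gtn i) ds' -> (0 < y')%R ->
    frac i y' a' (rcons ds' 1) -> a' != 0%R.
  move=> ads' y'0 fa'; apply/eqP => a0; rewrite a0 in fa'.
  have := frac0 _ y'0 fa'; rewrite !all_rcons /= i_gt1 ads'.
  by move/(_ isT).
elim: ds d a b y l => [|e ds IHds] d a b y l dN ads y0 fa fb.
  have ads1 : all (gtn i) [:: 1] by rewrite /= i_gt1.
  have [a' [b' [y' [es y'0 fa' fb']]]] := ev_input_step q dN ads1 y0 fa fb.
  rewrite /= in fa'; exists (q, inord 1), b', y'; split=> //; split.
    exact: nza fa.
  by rewrite es fa'.
have ads1 : all (gtn i) (rcons (e :: ds) 1) by rewrite all_rcons /= i_gt1.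
have [a' [b' [y' [es y'0 fa' fb']]]] := ev_input_step q dN ads1 y0 fa fb.
have /andP[ei ads'] := ads.
have eN : e <= N by rewrite /= in ei; lia.
have [v [b2 [y2 [lo y20 fb2]]]] := IHds e a' b' y' _ eN ads' y'0 fa' fb'.
exists v, b2, y2; split=> //.
  by split; [exact: nza fa | rewrite es].
by move: fb2; rewrite /= !rev_cons !cat_rcons.
Qed.

(** * Writing the output *)

Lemma ev_output_step q d (a y : int) Y x r :
  (0 < y)%R -> frac B y a (map symn (x :: r)) -> exists d' a',
  ev mv output_step (St (q, inord d) a (Posz Y) y) =
    St (q, inord d') a' (Posz (if x == blank then Y else j * Y + undout x)) y
  /\ frac B y a' (map symn r).
Proof.
move=> y0 [a' [ea fa']]; have bd := frac_bounds (all_symn_lt _) y0 fa'.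
rewrite ev_Seq (ev_popA _ _ ea bd) ?symn_le ?(ltnW (symn_lt _)) //.
rewrite /= inordK ?ltnS ?symn_le // lt0n symn_eq0.
case: eqP => [_|_] /=; first by exists (symn x), a'.
exists (undout x), a'; split=> //.
rewrite ev_digit_times => [|[v {}a b {}y]] //.
rewrite iter_IncC /set_digit /= symnK inordK ?ltnS ?undout_le //.
by rewrite (minn_idPr (undout_le _)) mulr1 mvj.
Qed.

Lemma output_loop r q d (a y : int) Y :
  (0 < y)%R -> frac B y a (map symn r) -> exists n s',
  [/\ n <= size r,
      loops mv (Nz RA) output_step n (St (q, inord d) a (Posz Y) y) s' &
      sb s' = Posz (foldl (fun n x =>
        if x == blank then n else j * n + undout x) Y r)].
Proof.
move=> y0; elim: r d a Y => [|x r IHr] d a Y fa.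
  by exists 0, (St (q, inord d) a (Posz Y) y); rewrite /= fa.
(* The loop may stop before [r] is exhausted; the remaining cells are then blank and do not affect
   the fold. *)
case a0: (a == 0%R).
  exists 0, (St (q, inord d) a (Posz Y) y); split=> //; first by rewrite /= a0.
  rewrite [sb _]/=; move: a0; rewrite (frac_eq0 y0 fa).
  by elim: (x :: r) => //= z t IHt /andP[-> /IHt].
have [d' [a' [es fa']]] := ev_output_step q d Y y0 fa.
have [n [s' [le lo e]]] :=
  IHr d' a' (if x == blank then Y else j * Y + undout x) fa'.
by exists n.+1, s'; split=> //; split; [rewrite /= a0 | rewrite es].
Qed.

Lemma foldl_filter_output l n :
  foldl (fun n x => if x == blank then n else j * n + undout x) n l =
    foldl (fun n d => j * n + d) n (map undout (filter (predC1 blank) l)).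
Proof. by elim: l n => //= x l IHl n; rewrite IHl; case: eqP. Qed.

(** Output digits are nonblank and all other cells blank, so filtering isolates the digits.
    Agreement up to blanks suffices, since rewinding may lose blanks on the left. *)
Lemma foldl_tm_output l (c : tm_config M) y : tm_output c y ->
  filter (predC1 blank) l =
    filter (predC1 blank) (rev (tm_left c) ++ tm_right c) ->
  foldl (fun n x => if x == blank then n else j * n + undout x) 0 l = y.
Proof.
case=> a [b ->] e; rewrite foldl_filter_output e !filter_cat.
have blanks n : filter (predC1 blank) (nseq n blank) = [::].
  by elim: n => //= n ->; rewrite eqxx.
rewrite !blanks cats0 /=; have ad := digits_lt j_gt1 y.
rewrite (_ : filter _ _ = map (tm_dout M) (digits j y)).
  rewrite -map_comp (_ : map _ _ = digits j y) ?horner_digits //.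
    exact: horner_digits.
  by rewrite -[RHS]map_id; apply/eq_in_map => d /(allP ad)/undoutK.
apply/all_filterP/allP => _ /mapP[d /(allP ad) dj ->]; exact: tm_dout_blank.
Qed.

Lemma filter_blank l : all (pred1 blank) l -> filter (predC1 blank) l = [::].
Proof. by elim: l => //= z l IHl /andP[-> /IHl]. Qed.

(** The fraction [(i x + 1) / i ^ (n + 1)] has the [n] digits of [x] followed by the marker 1. *)
Lemma first_pop (v : V) x : let ds := digits i x in exists a y : int,
  [/\ ev mv (pop mv mi RA)
        (St v (Posz (i * x + 1)) 0%R (Posz (i ^ (size ds).+1))) =
        St (v.1, inord (head 0 ds)) a 0%R y,
      (0 < y)%R & frac i y a (rcons (behead ds) 1)].
Proof.
move=> ds; have ads : all (gtn i) ds := digits_lt i_gt1 x.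
have y0 : (0 < Posz (i ^ (size ds).+1))%R.
  by rewrite ltz_nat expn_gt0 ltnW.
have fx : frac i (Posz (i ^ (size ds).+1)) (Posz (i * x + 1)) (rcons ds 1).
  have := frac_horner i 1 (rcons ds 1).
  by rewrite muln1 mul1n size_rcons /horner -cats1 foldl_cat /= -/(horner _ _)
    horner_digits.
have := size_digits_gt0 i x; rewrite -/ds; case: (ds) ads fx y0 => //.
move=> d ds' /andP[di ads'] [a' [ea fa]] y0 _.
have ads1 : all (gtn i) (rcons ds' 1) by rewrite all_rcons /= i_gt1.
have bd := frac_bounds ads1 y0 fa; rewrite /= in di.
exists a', (Posz (i ^ (size (d :: ds')).+1)); split=> //.
by rewrite -[in X in (X * _)%R]mvi in ea; apply: ev_popA ea bd _ _; lia.
Qed.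

(** * Composition of the phases and their total cost *)

Lemma simulator_correct x t c y :
  run (@tm_step i j M) t (tm_init M x) = Some c -> tm_step c = None ->
  tm_output c y -> exists n s,
  [/\ irun mv simulator (St (tm_start M, inord 0) (Posz x) 0%R 0%R) n s,
      sb s = Posz y & n <= 10 * (t + size (digits i x))].
Proof.
move=> rc hc oc; set ds := digits i x.
have ads : all (gtn i) ds := digits_lt i_gt1 x.
have ds0 : 0 < size ds := size_digits_gt0 i x.
have dsE : head 0 ds :: behead ds = ds by case: (ds) ds0.
have [m sm] : exists m, 1 + m = size ds by exists (size ds).-1; lia.
have lo1 := scale_loop (tm_start M, inord 0) (ltnSn 0) sm.
have [a1 [y1 [e1 y10 fa1]]] := first_pop (tm_start M, inord 0) x.
have [hN adst] : head 0 ds <= N /\ all (gtn i) (behead ds).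
  by move: ads; rewrite -dsE /= => /andP[di ->]; split=> //; lia.
have [v2 [b2 [y2 [lo2 y20 fb2]]]] :=
  input_loop (tm_start M) hN adst y10 fa1
    (erefl : frac B y1 0%R (map symn [::])).
(* All digits were pushed to the left, so the head now stands on the blank after the input. *)
have t2 : tape (tm_start M) blank (rev (map (tm_din M) ds)) [::]
    (St (tm_start M, inord 0 : 'I_N.+1) 0%R b2 y2).
  exists 0%R, b2, y2; rewrite symn_blank; split=> //.
  by rewrite -dsE -[rev _]cats0.
have [n3 [s3 [x3 [l3 [r3 [le3 lo3 t3 al3 e3]]]]]] := tape_rewind t2.
(* Input digits are not blank, so the rewind leaves nothing behind: [l3] is empty. *)
have r3E : r3 = map (tm_din M) ds.
  move: e3; rewrite revK cats0; case: l3 al3 => [//|z l3] /= /andP[/eqP-> _] e3.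
  have : blank \in map (tm_din M) ds by rewrite -e3 mem_cat mem_rev mem_head.
  by case/mapP=> d /(allP ads)/(tm_din_blank M) + e; rewrite -e eqxx.
have t4 : represents (tm_init M x) (ev mv (pop mv mb RA) s3).
  by rewrite /represents /= -/ds -r3E; apply: tape_popA t3.
have [s5 [lo5 t5 sz5]] := represents_run t4 rc hc.
have t6 := tape_pushA t5.
have [n7 [s7 [x7 [l7 [r7 [le7 lo7 t7 al7 e7]]]]]] := tape_rewind t6.
case: t7 => a7 [b7 [y7 [s7E y70 fb7 fa7]]].
have {}fb7 : b7 = Posz 0 := fb7.
have [n8 [s8 [le8 lo8 e8]]] := output_loop (tm_ctl c) (symn x7) 0 y70 fa7.
(* These are the iterations of the six loops: the first three take at most [size ds] each, the
   fourth [t], the last two at most [size ds + 2 * t + 1] each by the bound on the tape size. *)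
exists (m + ((size (behead ds)).+1 + (n3 + (t + (n7 + (n8 + 0)))))), s8; split.
- apply: irun_blk; apply: irun_while.
    by rewrite expn1 in lo1; exact: lo1.
  apply: irun_blk; rewrite [ev _ _ _](_ : _ = St (tm_start M, inord 0)
    (Posz (i * x + 1)) 0%R (Posz (i ^ (size ds).+1))); last first.
    by rewrite /= mvi PoszD PoszM expnS PoszM.
  apply: irun_blk; rewrite e1; apply: irun_while; first exact: lo2.
  apply: irun_blk; apply: irun_while; first exact: lo3.
  apply: irun_blk; apply: irun_while; first exact: lo5.
  apply: irun_blk; apply: irun_while; first exact: lo7.
  apply: irun_while; last exact: irun_nil.
  by rewrite s7E fb7.
- rewrite e8; congr Posz; apply: foldl_tm_output oc _.
  rewrite -[LHS]cat0s -(filter_blank (l := rev l7)) ?all_rev // -filter_cat e7.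
  (* If the head is on an unlisted cell, pushing it lists one more blank, which the filter
     removes. *)
  by rewrite !filter_cat; case: (tm_right c) => //=; rewrite eqxx.
- have r7s := congr1 size e7; rewrite !size_cat !size_rev /= size_behead in r7s.
  rewrite size_rev size_map in le3; rewrite size_behead.
  by move: sz5; rewrite /tape_size /tm_init /= size_map -/ds; lia.
Qed.

End Simulation.

(** The number of registers enters only through [mulc]: it suffices to multiply in place by [i], by
    [j] and by some sufficiently large tape base. *)
Lemma simulation (k : nat) (MI : Type) (mv : MI -> nat) (emb : reg -> 'I_k)
    (mulc : forall V : finType, MI -> 'I_k -> seq (command k V))
    (F f : nat -> nat) (i j : nat) (M : tm i j) (mi mj : MI) :
  injective emb -> (forall V, implements_mul mv emb (mulc V)) ->
  (forall n, exists m, n < mv m) -> mv mi = i -> mv mj = j ->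
  1 < i -> 1 < j -> tm_computes_in M F f ->
  rm_computable_in_O k i F (fun n => f n + n).
Proof.
move=> emb_inj mulcP mv_unbounded mvi mvj i_gt1 j_gt1 MF.
have [mb mvb] := mv_unbounded #|tm_symbol M|.
have [P [C PC]] := compile_correct emb_inj (mulcP _)
  (tm_start M, inord 0) (simulator M mv mi mj mb).
(* The iteration count plus one is at most [10 * (t + d) + 1], where the number [d] of digits is at
   least 1; hence 11. *)
exists P, (C * 11) => x; have [t [c [le_t rc hc oc]]] := MF x.
have [n [s [ir sbs le_n]]] :=
  simulator_correct mvi mvj i_gt1 j_gt1 mvb rc hc oc.
have [t' [c' [le_t' rc' hc' oc']]] := PC _ _ _ _ ir sbs.
exists t', c'; split=> //; apply: leq_trans le_t' _.
rewrite -mulnA leq_mul2l; apply/orP; right.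
by have := size_digits_gt0 i x; lia.
Qed.

(** * Multiplication in place, with and without a scratch register *)

Definition embed e (x : reg) : 'I_e.+3 :=
  inord (match x with RA => 0 | RB => 1 | RY => 2 end).

Lemma val_embed e x :
  embed e x = (match x with RA => 0 | RB => 1 | RY => 2 end) :> nat.
Proof. by case: x; rewrite inordK. Qed.

Lemma embed_inj e : injective (@embed e).
Proof.
by move=> x z /(congr1 val); rewrite /= !val_embed; case: x; case: z.
Qed.

Definition double (V : finType) k (m : nat) (x : 'I_k) : seq (command k V) :=
  nseq m (Add V x x x).

Lemma double_implements V :
  implements_mul (expn 2) (@embed 0) (@double V 3).
Proof.
move=> m x; split; first by rewrite all_nseq orbT.
move=> r s rs; apply: (agrees_set (@embed_inj _) _ rs) => z.
rewrite -[get s x]rs /double; elim: m r {rs} => [|m IHm] r /=.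
  by rewrite mul1r; case: eqP => [->|].
rewrite IHm !ffunE eqxx; case: eqP => // _.
by rewrite expnS PoszM -mulrA mulrDr; lia.
Qed.

(** Adding [c] copies to the original multiplies by [c.+1], hence the multiplier map [succn]. *)
Definition mul_scratch (V : finType) (c : nat) (x : 'I_4) :
    seq (command 4 V) :=
  AddC V (inord 3) x 0%R :: nseq c (Add V x x (inord 3)).

Lemma mul_scratch_implements V :
  implements_mul succn (@embed 1) (@mul_scratch V).
Proof.
have tmpE x : (embed 1 x == inord 3) = false.
  by apply/negbTE; rewrite -val_eqE /= val_embed inordK //; case: x.
move=> c x; split; first by rewrite /= all_nseq orbT.
move=> r s rs; apply: (agrees_set (@embed_inj _) _ rs) => z.
rewrite -[get s x]rs {rs} /=; set r1 := upd _ _ _.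
have -> n r' : foldl (@assign 4 V) r' (nseq n (Add V (embed 1 x) (embed 1 x)
    (inord 3))) (embed 1 z) = if embed 1 z == embed 1 x
    then (r' (embed 1 x) + n%:Z * r' (inord 3))%R else r' (embed 1 z).
  elim: n r' => [|n IHn] r' /=.
    by rewrite mul0r addr0; case: eqP => [->|].
  rewrite IHn !ffunE eqxx [inord 3 == _]eq_sym tmpE; case: eqP => // _.
  by rewrite -[n.+1]addn1 PoszD mulrDl mul1r -addrA [X in (_ + X)%R]addrC.
rewrite !ffunE !tmpE eqxx addr0 intS mulrDl mul1r.
by case: eqP.
Qed.

Theorem theorem14 (F f : nat -> nat) :
  (forall (k l : nat) (M : tm (2 ^ k) (2 ^ l)),
     0 < k -> 0 < l -> tm_computes_in M F f ->
     rm_computable_in_O 3 (2 ^ k) F (fun n => f n + n)) /\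
  (forall (i j : nat) (M : tm i j),
     2 <= i -> 2 <= j -> tm_computes_in M F f ->
     rm_computable_in_O 4 i F (fun n => f n + n)).
Proof.
split=> [k l M k0 l0 MF | i j M i2 j2 MF].
  (* Multipliers are indexed by exponents of 2, and [n < 2 ^ n] provides a large enough tape
     base. *)
  apply: (simulation (mi := k) (mj := l) (@embed_inj 0) double_implements)
    erefl erefl _ _ MF; last 2 first.
  - by rewrite -(expn0 2) ltn_exp2l.
  - by rewrite -(expn0 2) ltn_exp2l.
  by move=> n; exists n; apply: ltn_expl.
have [i0 j0] := (ltnW i2, ltnW j2).
apply: (simulation (@embed_inj 1) mul_scratch_implements)
  (prednK i0) (prednK j0) i2 j2 MF.
by move=> n; exists n.
Qed.
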